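(* Let $S\neq\mathbb{N}$ be an almost symmetric numerical semigroup, and let $A^{\star}(S)=S\cup PF(S)$ (which is again a numerical semigroup). Then $A^{\star}(S)$ is almost symmetric if and only if the numerical semigroup $S\cup\{F(S)\}$ has max embedding dimension.
   Context: $\mathbb{N}=\{0,1,2,\dots\}$. A numerical semigroup is a subset $S\subseteq\mathbb{N}$ containing $0$, closed under addition, with finite complement in $\mathbb{N}$. The elements of $\mathbb{N}\setminus S$ are the gaps of $S$; the genus $g(S)$ is the number of gaps; for $S\neq\mathbb{N}$ the Frobenius number $F(S)$ is the largest gap; the multiplicity $m(S)$ is the smallest nonzero element. The set of pseudo-Frobenius numbers is $PF(S)=\{x\in\mathbb{N}\setminus S \mid x+s\in S \text{ for all } s\in S\setminus\{0\}\}$, and the type is $t(S)=|PF(S)|$. $S\neq \mathbb{N}$ is called almost symmetric if $t(S)=2g(S)-F(S)$; by convention $\mathbb{N}$ itself is regarded as almost symmetric (with $F(\mathbb{N})=-1$, $t(\mathbb{N})=1$). A numerical semigroup has max embedding dimension if the number of elements of its minimal generating set equals its multiplicity. *)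

(* Defs.v *)
From mathcomp Require Import all_boot all_order all_algebra finmap.
From mathcomp Require Import boolp classical_sets functions cardinality.
From mathcomp Require Import zify.

Set Implicit Arguments.
Unset Strict Implicit.
Unset Printing Implicit Defensive.

Import Order.TTheory GRing.Theory Num.Theory.
Local Open Scope classical_set_scope.

Definition gaps (S : set nat) : set nat := ~` S.

Definition submonoid (S : set nat) : Prop :=
  S 0 /\ (forall x y, S x -> S y -> S (x + y)).

Definition numerical_semigroup (S : set nat) : Prop :=
  submonoid S /\ finite_set (~` S).

(* [fset_set] is only meaningful on finite sets; the cardinals below are
   applied to sets that are finite when [S] is a numerical semigroup. *)
Definition genus (S : set nat) : nat := #|` fset_set (gaps S)|.

(* An integer, because of the convention F(N) = -1. *)
Definition frobenius (S : set nat) : int :=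
  if `[< S = setT >] then (-1)%R
  else Posz (get (gaps S `&` ubound (gaps S))).

Definition multiplicity (S : set nat) : nat :=
  let S1 := S `\ 0 in get (S1 `&` lbound S1).

(* On S = N this is empty, whereas the convention t(N) = 1 corresponds to
   PF(N) = {-1}; hence the case distinction in [semigroup_type]. *)
Definition pseudo_frobenius (S : set nat) : set nat :=
  [set x | gaps S x /\ forall s, (S `\ 0) s -> S (x + s)].

Definition semigroup_type (S : set nat) : nat :=
  if `[< S = setT >] then 1 else #|` fset_set (pseudo_frobenius S)|.

(* An equation in Z, so that the subtraction is not truncated.  It holds for
   S = N by the conventions above: see [almost_symmetric_setT]. *)
Definition almost_symmetric (S : set nat) : Prop :=
  Posz (semigroup_type S) = (2 * Posz (genus S) - frobenius S)%R.

Definition generated (G : set nat) : set nat := smallest submonoid G.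

Definition is_minimal_generating_set (S G : set nat) : Prop :=
  generated G = S /\ forall H, H `<=` G -> generated H = S -> H = G.

(* "The" minimal generating set: it exists and is unique, see
   [minimal_generating_set_exists] and [minimal_generating_set_unique]. *)
Definition minimal_generating_set (S : set nat) : set nat :=
  get (is_minimal_generating_set S).

Definition embedding_dimension (S : set nat) : nat :=
  #|` fset_set (minimal_generating_set S)|.

Definition max_embedding_dimension (S : set nat) : Prop :=
  embedding_dimension S = multiplicity S.

Definition Astar (S : set nat) : set nat := S `|` pseudo_frobenius S.

(* For S = N the added set is empty, as F(N) = -1. *)
Definition add_frobenius (S : set nat) : set nat :=
  S `|` [set x | Posz x = frobenius S].

Lemma almost_symmetric_setT : almost_symmetric setT.
Proof.
rewrite /almost_symmetric /semigroup_type /genus /frobenius /gaps.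
by rewrite asboolT // setCT fset_set0 cardfs0.
Qed.

Lemma frobeniusP (S : set nat) : numerical_semigroup S -> S <> setT ->
  exists f : nat, [/\ frobenius S = Posz f, ~ S f &
    forall x, ~ S x -> x <= f].
Proof.
move=> [_ finS] SN; rewrite /frobenius asboolF //.
set A := _ `&` _.
suff [f Af] : A !=set0.
  exists (get A); have [h1 h2] := getI Af.
  by split => // x Sx; apply: h2.
have [g Sg] : exists g, ~ S g.
  by apply/existsNP => h; apply: SN; apply/seteqP; split.
have gin : g \in fset_set (gaps S) by rewrite in_fset_set // inE.
pose P n := n \in fset_set (gaps S).
have exP : exists n, P n by exists g.
have bP n : P n -> n <= \max_(x <- fset_set (gaps S)) x.
  by move=> Pn; apply: leq_bigmax_seq.
case: (ex_maxnP exP bP) => f Pf maxf.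
exists f; split; first by move: Pf; rewrite /P in_fset_set // inE.
by move=> x Sx; apply: maxf; rewrite /P in_fset_set // inE.
Qed.

Lemma multiplicityP (S : set nat) : numerical_semigroup S ->
  [/\ S (multiplicity S), multiplicity S != 0 &
      forall x, S x -> x != 0 -> multiplicity S <= x].
Proof.
move=> [[S0 SD] finS]; rewrite /multiplicity.
set S1 := S `\ 0; set A := _ `&` _.
suff [m Am] : A !=set0.
  have [[h1 h1'] h2] := getI Am.
  split => //; first exact/eqP.
  by move=> x Sx /eqP x0; apply: h2.
have exP : exists n, `[< S1 n >].
  apply: contrapT => h; apply: infinite_nat.
  have : finite_set (~` S `|` [set 0]) by rewrite finite_setU.
  apply: sub_finite_set => n _.
  have [->|n0] := eqVneq n 0; [by right|left => Sn; apply: h; exists n].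
  by apply/asboolP; split => //; apply/eqP.
case: (ex_minnP exP) => m /asboolP Sm minm.
by exists m; split => // x Sx; apply: minm; apply/asboolP.
Qed.

Lemma Astar_numerical_semigroup (S : set nat) :
  numerical_semigroup S -> numerical_semigroup (Astar S).
Proof.
move=> [[S0 SD] finS]; split; last first.
  by apply: sub_finite_set finS => x nx Sx; apply: nx; left.
have SPF x y : S x -> pseudo_frobenius S y -> Astar S (x + y).
  move=> Sx PFy; have [->|x0] := eqVneq x 0; first by right; rewrite add0n.
  by left; rewrite addnC; apply: PFy.2; split => //; apply/eqP.
split; first by left.
move=> x y [Sx|PFx] [Sy|PFy]; first by left; apply: SD.
- exact: SPF.
- by rewrite addnC; apply: SPF.
- have [Sxy|nSxy] := pselect (S (x + y)); [by left|right; split => // s Ss].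
  rewrite -addnA; apply: PFx.2; split; first exact: PFy.2.
  by case: Ss => _ /eqP s0 /= /eqP; rewrite addn_eq0 (negbTE s0) andbF.
Qed.

Lemma add_frobenius_numerical_semigroup (S : set nat) :
  numerical_semigroup S -> numerical_semigroup (add_frobenius S).
Proof.
move=> NS; have [[S0 SD] finS] := NS; split; last first.
  by apply: sub_finite_set finS => x nx Sx; apply: nx; left.
split; first by left.
have [SN|SN] := pselect (S = setT); first by move=> x y _ _; left; rewrite SN.
have [f [Ff nSf fmax]] := frobeniusP NS SN.
have f0 : f != 0 by apply/eqP => f0; apply: nSf; rewrite f0.
have Sgt x : f < x -> S x.
  by move=> fx; apply: contrapT => /fmax; rewrite leqNgt fx.
have addf x : S x -> add_frobenius S (x + f).
  have [->|x0] := eqVneq x 0; first by right; rewrite /= Ff.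
  by left; apply: Sgt; lia.
move=> x y [Sx|Fx] [Sy|Fy].
- by left; apply: SD.
- by move: Fy; rewrite /= Ff => -[->]; apply: addf.
- by move: Fx; rewrite /= Ff => -[->]; rewrite addnC; apply: addf.
- by move: Fx Fy; rewrite /= Ff => -[->] [->]; left; apply: Sgt; lia.
Qed.

Lemma generated_submonoid (G : set nat) : submonoid (generated G).
Proof.
split=> [A [[]]//|x y Gx Gy A hA].
by have [[_ AD] _] := hA; apply: AD; [apply: Gx|apply: Gy].
Qed.

Definition irreducibles (S : set nat) : set nat :=
  [set x | (S `\ 0) x /\
     forall y z, (S `\ 0) y -> (S `\ 0) z -> x <> y + z].

Lemma irreducibles_sub (S G : set nat) :
  generated G = S -> irreducibles S `<=` G.
Proof.
move=> GS x [[Sx x0] xirr]; apply: contrapT => nGx.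
have [S0 SD] : submonoid S by rewrite -GS; apply: generated_submonoid.
have GsubS : G `<=` S by rewrite -GS => y Gy A [_]; apply.
suff : (S `\ x) x by case=> _; apply.
rewrite -{1}GS in Sx; apply: Sx; split; last first.
  by move=> y Gy; split; [exact: GsubS|move=> yx; apply: nGx; rewrite -yx].
split; first by split => // e; apply: x0; rewrite /= -e.
move=> y z [Sy yx] [Sz zx]; split; first exact: SD.
move=> /= yzx.
have [y0|y0] := eqVneq y 0; first by apply: zx; rewrite /= -yzx y0.
have [z0|z0] := eqVneq z 0; first by apply: yx; rewrite /= -yzx z0 addn0.
by apply: (xirr y z) => //; split => //; apply/eqP.
Qed.

Lemma irreducibles_generate (S : set nat) :
  submonoid S -> generated (irreducibles S) = S.
Proof.
move=> SS; apply/seteqP; split.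
  by move=> x; apply; split => // y [[]].
move=> x Sx A [[A0 AD] IA].
elim/ltn_ind: x Sx => x IH Sx.
have [->//|x0] := eqVneq x 0.
have [xi|nxi] := pselect (irreducibles S x); first exact: IA.
apply: contrapT => nAx; apply: nxi; split; first by split => //; apply/eqP.
move=> y z [Sy /eqP /= y0] [Sz /eqP /= z0] xyz; apply: nAx.
by rewrite xyz; apply: AD; apply: IH => //; lia.
Qed.

Lemma minimal_generating_set_exists (S : set nat) : submonoid S ->
  is_minimal_generating_set S (minimal_generating_set S).
Proof.
move=> SS; apply: (@getI _ _ (irreducibles S)).
split; first exact: irreducibles_generate.
by move=> H Hsub HS; apply/seteqP; split => //; apply: irreducibles_sub.
Qed.

Lemma minimal_generating_set_unique (S G : set nat) :
  submonoid S -> is_minimal_generating_set S G ->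
  G = minimal_generating_set S.
Proof.
have uniq H : submonoid S -> is_minimal_generating_set S H ->
    irreducibles S = H.
  move=> SS [HS Hmin]; apply: Hmin; first exact: irreducibles_sub.
  exact: irreducibles_generate.
move=> SS GS; rewrite -(uniq _ SS GS); apply: uniq => //.
exact: minimal_generating_set_exists.
Qed.

(* Main.v *)
Require Import Defs.
From mathcomp Require Import all_boot all_order all_algebra finmap.
From mathcomp Require Import boolp classical_sets functions cardinality.
From mathcomp Require Import zify.

(** Write F = F(S), m = m(S).  Pairing x with F - x shows that S is almost
    symmetric iff every gap x such that F - x is also a gap is pseudo-Frobenius;
    comparing the irreducibles with the Apery set of m shows that a semigroup has
    max embedding dimension iff x + y - m belongs to it for all nonzero members
    x, y.  When m < F, the gaps of A*(S) are the F - s with s in S, 0 < s < F, so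
    F(A*(S)) = F - m and A*(S) is almost symmetric iff no s in S with 0 < s < F
    and m + F - s in S splits as a + b with a in A*(S), b in S both nonzero.
    If x + y - m is a gap u <> F, then s = x + y (when F - u is in S) or
    s = (F - u) + x (when F - u is a gap) violates this condition. *)

Local Open Scope classical_set_scope.

(** Turns cardinals into sums of indicators over an initial interval, so that counting identities
    can be checked pointwise. *)
Lemma card_fset_set_bounded (A : set nat) (N : nat) :
  (forall x, A x -> x < N) -> #|` fset_set A| = \sum_(i < N) `[< A i >].
Proof.
move=> AN.
have -> : fset_set A = [fset i in [seq i <- iota 0 N | `[< A i >]]]%fset.
  have finA : finite_set A.
    by apply: sub_finite_set (finite_II N) => x /AN.
  apply/fsetP => x; rewrite in_fset_set // !inE mem_filter mem_iota /=.
  apply/idP/idP; last by rewrite inE => /andP[/asboolP].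
  by rewrite inE => Ax; rewrite add0n AN // andbT; apply/asboolP.
rewrite card_fseq undup_id ?filter_uniq ?iota_uniq //.
rewrite size_filter -sum1_count -(big_mkord xpredT (fun i => `[< A i >] : nat)).
by rewrite /index_iota subn0 big_mkcond; apply: eq_bigr => i _; case: asboolP.
Qed.

(** Used twice below: the set of interest is embedded in a finite set of known size, and maximal
    cardinality becomes the reverse inclusion. *)
Lemma eq_card_fset_set_sub (A B : set nat) : finite_set B -> A `<=` B ->
  #|` fset_set A| = #|` fset_set B| <-> B `<=` A.
Proof.
move=> finB AB; have finA := sub_finite_set AB finB.
split=> [eqAB|BA]; last by have -> : A = B by apply/seteqP.
have sAB : (fset_set A `<=` fset_set B)%fset.
  by apply/fsubsetP => x; rewrite !in_fset_set // !inE; apply: AB.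
have [_] := fsubset_leqif_cards sAB.
by rewrite eqAB eqxx => /esym/eqP/fset_set_inj ->.
Qed.

Lemma frobeniusE (S : set nat) (f : nat) : ~ S f ->
  (forall x, f < x -> S x) -> frobenius S = Posz f.
Proof.
move=> nSf Sgt; rewrite /frobenius asboolF; last by move=> SN; apply: nSf; rewrite SN.
have lef x : ~ S x -> x <= f by move=> nSx; rewrite leqNgt; apply/negP => /Sgt.
set A := _ `&` _.
have [nSg gmax] : A (get A) by apply: (@getI _ _ f); split=> // x /lef.
have fg : f <= get A by apply: gmax.
by congr Posz; apply/eqP; rewrite eqn_leq fg andbT; apply: lef.
Qed.

(** PF(S) always lies in the set [L] below, which has 2g - f elements, so almost symmetry amounts to
    [L] being contained in PF(S). *)
Lemma almost_symmetricP (S : set nat) (f : nat) :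
  numerical_semigroup S -> ~ S f -> (forall x, f < x -> S x) ->
  almost_symmetric S <->
  (forall x, x <= f -> ~ S x -> ~ S (f - x) -> pseudo_frobenius S x).
Proof.
move=> [[S0 SD] finS] nSf Sgt.
have SN : S <> setT by move=> e; apply: nSf; rewrite e.
have ltf x : ~ S x -> x < f.+1.
  by move=> nSx; rewrite ltnS leqNgt; apply/negP => /Sgt.
(* The Frobenius number [f] is added by hand: its partner [f - f = 0] is not a gap. *)
pose L := [set x | x <= f /\ (x = f \/ (~ S x /\ ~ S (f - x)))].
have Lf x : L x -> x < f.+1 by case.
have finL : finite_set L by apply: sub_finite_set (finite_II f.+1) => x /Lf.
have PFL : pseudo_frobenius S `<=` L.
  move=> x [/= nSx PFx]; have xf := ltf _ nSx; split; first by rewrite -ltnS.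
  have [->|xf'] := eqVneq x f; [by left|right; split=> // Sfx].
  apply: nSf; have -> : f = x + (f - x) by lia.
  by apply: PFx; split => //= ?; lia.
have PFf : pseudo_frobenius S f.
  by split => // s [_ /= s0]; apply: Sgt; lia.
have cardL : #|` fset_set L| + f = 2 * genus S.
  rewrite (card_fset_set_bounded _ _ Lf) /genus (card_fset_set_bounded (gaps S) _ ltf).
  (* As [i] and [f - i] are never both in [S], the pair has one gap, or two when both are gaps. At
     [i = f] there is one gap although [f] is in [L]; the last term corrects this. *)
  have : \sum_(i < f.+1) (`[< L i >] + 1) =
      \sum_(i < f.+1) (`[< gaps S i >] + `[< gaps S (f - i) >] + (i == ord_max)).
    apply: eq_bigr => i _; have := ltn_ord i; rewrite ltnS => lif.
    rewrite -(inj_eq val_inj) /=.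
    have gapE j : `[< gaps S j >] = ~~ `[< S j >] by rewrite -asbool_neg.
    have -> : `[< L i >] = (i == f :> nat) || ~~ `[< S i >] && ~~ `[< S (f - i) >].
      rewrite -!asbool_neg -asbool_and; apply/asboolP/orP.
        by move=> [_ [->|h]]; [left|right; apply/asboolP].
      by move=> [/eqP ->|/asboolP h]; split; [|left| |right].
    rewrite !gapE; have [->|nif] := eqVneq (i : nat) f.
      by rewrite subnn (asboolF nSf) (asboolT S0).
    case: (asboolP (S i)) => Si; case: (asboolP (S (f - i))) => Sj //.
    by case: nSf; rewrite -(subnKC lif); apply: SD.
  rewrite !big_split /= sum1_card card_ord.
  have -> : \sum_(i < f.+1) (i == ord_max) = 1.
    by rewrite (bigD1 ord_max) //= eqxx big1 // => i /negbTE ->.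
  have -> : \sum_(i < f.+1) `[< gaps S (f - i) >] = \sum_(i < f.+1) `[< gaps S i >].
    rewrite [RHS](reindex_inj rev_ord_inj) /=.
    by apply: eq_bigr => i _; rewrite subSS.
  by move: (\sum_(i < f.+1) `[< L i >]) (\sum_(i < f.+1) `[< gaps S i >]) => a b; lia.
rewrite /almost_symmetric /semigroup_type asboolF // (frobeniusE _ _ nSf Sgt).
have -> : (Posz #|` fset_set (pseudo_frobenius S)| =
           2 * Posz (genus S) - Posz f)%R <->
          #|` fset_set (pseudo_frobenius S)| = #|` fset_set L| by split; lia.
rewrite eq_card_fset_set_sub //; split=> [LPF x xf nSx nSfx|LPF x [xf [->|[]]]] //.
  by apply: LPF; split => //; right.
exact: LPF.
Qed.

Lemma minimal_generating_setE (S : set nat) : submonoid S ->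
  minimal_generating_set S = irreducibles S.
Proof.
move=> SS; apply/esym/minimal_generating_set_unique => //.
split; first exact: irreducibles_generate.
by move=> H HI HS; apply/seteqP; split => //; apply: irreducibles_sub.
Qed.

(** The irreducibles lie in a set [B] of m elements, so the dimension is maximal iff no element of
    [B] splits. A sum [x + y] of nonzero elements exceeds m, hence lies in [B] exactly when
    [x + y - m] is outside [S]. *)
Lemma max_embedding_dimensionP (S : set nat) : numerical_semigroup S ->
  max_embedding_dimension S <->
  (forall x y, (S `\ 0) x -> (S `\ 0) y -> S (x + y - multiplicity S)).
Proof.
move=> NS; have [[S0 SD] finS] := NS; have [Sm m0 mmin] := multiplicityP NS.
rewrite /max_embedding_dimension /embedding_dimension minimal_generating_setE //.
set m := multiplicity S in Sm m0 mmin *.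
have [N [N0 SN]] : exists N, 0 < N /\ forall x, N <= x -> S x.
  have [->|/(frobeniusP NS)[f [_ _ fmax]]] := pselect (S = setT).
    by exists 1.
  exists f.+1; split => // x fx; apply: contrapT => /fmax.
  by rewrite leqNgt fx.
(* The Apery set of m, with 0 replaced by m. *)
pose B := [set w | S w /\ w <> 0 /\ (w = m \/ ~ (m <= w /\ S (w - m)))].
have BN w : B w -> w < N + m.
  move=> [_ [_ [->|nw]]]; first by lia.
  rewrite ltnNge; apply/negP => Nw; apply: nw; split; first by lia.
  by apply: SN; lia.
have IB : irreducibles S `<=` B.
  move=> w [[Sw w0] wirr]; split => //; split => //.
  have [->|wm] := eqVneq w m; [by left|right => -[mw Swm]].
  by apply: (wirr m (w - m)); [split=> //; exact/eqP|split => //= ?; lia|lia].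
have finB : finite_set B by apply: sub_finite_set (finite_II (N + m)) => x /BN.
have cardB : #|` fset_set B| = m.
  rewrite (card_fset_set_bounded _ _ BN).
  (* An element [i] of [S] either lies in [B] or has [i - m] in [S], except that 0 does neither and
     m does both. Summing gives the size of [B] as the number of elements of [S] in [[N, N + m)],
     which is m. *)
  have : \sum_(i < N + m) (`[< B i >] + `[< m <= i /\ S (i - m) >] + (i == 0 :> nat)) =
         \sum_(i < N + m) (`[< S i >] + (i == m :> nat)).
    apply: eq_bigr => i _; rewrite /B.
    have -> : `[< B i >] = [&& `[< S i >], (i != 0 :> nat) &
        (i == m :> nat) || ~~ `[< m <= i /\ S (i - m) >]].
      rewrite -asbool_neg; apply/asboolP/and3P.
        move=> [Si [/eqP i0 im]]; split; [exact/asboolP|by []|].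
        by case: im => [->|nim]; rewrite ?eqxx //; apply/orP; right; apply/asboolP.
      move=> [/asboolP Si /eqP i0 im]; split=> //; split=> //.
      by move: im => /orP[/eqP|/asboolP]; [left|right].
    have [->|i0] := eqVneq (i : nat) 0.
      by rewrite (asboolT S0) asboolF ?[0 == m]eq_sym ?(negbTE m0) // => -[]; lia.
    have [->|im] := eqVneq (i : nat) m.
      by rewrite subnn (asboolT Sm) asboolT.
    case: (asboolP (S i)) => Si; case: (asboolP (_ /\ _)) => // -[mi Sim].
    by case: Si; rewrite -(subnK mi); apply: SD.
  rewrite !big_split.
  have one k : k < N + m -> \sum_(i < N + m) (i == k :> nat) = 1.
    move=> kN; rewrite (bigD1 (Ordinal kN)) //= eqxx big1 // => i.
    by rewrite -(inj_eq val_inj) /= => /negbTE ->.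
  rewrite !one; [|lia..].
  have -> : \sum_(i < N + m) `[< m <= i /\ S (i - m) >] = \sum_(i < N) `[< S i >].
    rewrite addnC big_split_ord /= big1 ?add0n.
      apply: eq_bigr => i _; rewrite addKn.
      by congr (nat_of_bool _); apply: asbool_equiv_eq; split => [[]//|]; split => //; lia.
    by move=> i _; rewrite asboolF // => -[]; have := ltn_ord i; lia.
  rewrite (big_split_ord _ _ (fun i => `[< S i >] : nat)) /=.
  have -> : \sum_(i < m) `[< S (N + i) >] = m.
    rewrite (eq_bigr (fun=> 1)) ?sum1_card ?card_ord // => i _.
    by rewrite asboolT //; apply: SN; lia.
  by lia.
have -> : #|` fset_set (irreducibles S)| = m <->
          #|` fset_set (irreducibles S)| = #|` fset_set B| by rewrite cardB.
rewrite eq_card_fset_set_sub //.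
split=> [BI x y Sx Sy|H w [Sw [w0 wB]]].
  apply: contrapT => nS; have mx : m <= x by apply: mmin; [exact: Sx.1|exact/eqP/Sx.2].
  have /BI[_ /(_ x y Sx Sy)] // : B (x + y).
  have := Sx.2 => /= x0; split; first by apply: SD; [exact: Sx.1|exact: Sy.1].
  by split; [lia|right => -[]].
split => // x y Sx Sy wxy.
have mx : m <= x by apply: mmin; [exact: Sx.1|exact/eqP/Sx.2].
have := Sy.2 => /= y0; case: wB => [|nw]; first by lia.
by apply: nw; split; [lia|rewrite wxy; apply: H].
Qed.

Theorem theorem1p3 (S : set nat) (hS : numerical_semigroup S)
  (hSN : S <> [set: nat]%classic) (hAS : almost_symmetric S) :
  almost_symmetric (Astar S) <-> max_embedding_dimension (add_frobenius S).
Proof.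
have [[S0 SD] _] := hS; have [f [Ff nSf fmax]] := frobeniusP hS hSN.
have Sgt x : f < x -> S x.
  by move=> fx; apply: contrapT => /fmax; rewrite leqNgt fx.
have f0 : f <> 0 by move=> e; apply: nSf; rewrite e.
have LPF := (almost_symmetricP _ _ hS nSf Sgt).1 hAS.
have NS' := add_frobenius_numerical_semigroup hS.
have NA := Astar_numerical_semigroup hS.
have [Sm m0 mmin] := multiplicityP hS; set m := multiplicity S in Sm m0 mmin.
have S'P x : add_frobenius S x <-> S x \/ x = f.
  rewrite /add_frobenius /= Ff.
  by split => -[?|]; [left|case; right|left|move=> ->; right].
(* Outside A*(S), [LPF] forces [f - x] into [S]; conversely, [x] in A*(S) would put
   [f = x + (f - x)] in [S]. *)
have gapA x : ~ Astar S x <-> x < f /\ S (f - x).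
  split=> [nAx|[xf Sfx] [Sx|[_ PFx]]].
  - have xf : x <= f by apply: fmax => Sx; apply: nAx; left.
    have nSx : ~ S x by move=> Sx; apply: nAx; left.
    split; last by apply: contrapT => nSfx; apply: nAx; right; apply: LPF.
    rewrite ltn_neqAle xf andbT; apply/eqP => e; apply: nAx; right.
    by rewrite e; split => // s [_ /= s0]; apply: Sgt; lia.
  - by apply: nSf; rewrite -(subnKC (ltnW xf)); apply: SD.
  - apply: nSf; rewrite -(subnKC (ltnW xf)); apply: PFx.
    by split => //=; lia.
have [S'm' m'0 m'min] := multiplicityP NS'.
rewrite max_embedding_dimensionP //.
set m' := multiplicity _ in S'm' m'0 m'min *.
(* If [f < m], both sides hold: A*(S) is everything, and the nonzero elements of [add_frobenius S]
   are the integers from [f] on. *)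
have [fm|mf] := ltnP f m.
  have AT : Astar S = setT.
    apply/seteqP; split => // x _; apply: contrapT => /gapA[xf Sfx].
    have : m <= f - x by apply: mmin => //; lia.
    by lia.
  rewrite AT; split=> [_ x y [S'x x0] [S'y y0]|_]; last exact: almost_symmetric_setT.
  have S'f x' : S x' -> x' <> 0 -> f < x'.
    by move=> Sx' /eqP/(mmin _ Sx'); lia.
  have m'f : m' <= f by apply: m'min; [apply/S'P; right|exact/eqP].
  have fx x' : (add_frobenius S) x' -> x' <> 0 -> f <= x'.
    by move=> /S'P[Sx' /(S'f _ Sx')/ltnW|->].
  have := fx _ S'x x0; have := fx _ S'y y0 => fy fx'.
  apply/S'P; have [->|] := eqVneq (x + y - m') f; [by right|left].
  by apply: Sgt; lia.
have {}mf : m < f by rewrite ltn_neqAle mf andbT; apply/eqP => e; apply: nSf; rewrite -e.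
have m'E : m' = m.
  apply/eqP; rewrite eqn_leq m'min //=; last by apply/S'P; left.
  by move/S'P: S'm' => [Sm'|->]; [exact: mmin|exact: ltnW].
rewrite m'E.
have nAfm : ~ Astar S (f - m) by apply/gapA; rewrite subKn ?(ltnW mf) //; split => //; lia.
have Agt x : f - m < x -> Astar S x.
  move=> fmx; apply: contrapT => /gapA[xf Sfx].
  have : m <= f - x by apply: mmin => //; lia.
  by lia.
rewrite (almost_symmetricP _ _ NA nAfm Agt); split=> H.
(* Almost symmetry of A*(S) is applied to its gap [f - s], whose partner [s - m] is a gap because
   [m + f - s] is in [S]. Thus [f - s + a] is in A*(S), that is, [s - a] is not in [S]. *)
- have key s a : S s -> s < f -> S (m + f - s) -> Astar S a -> a <> 0 ->
      a < s -> ~ S (s - a).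
    move=> Ss sf Smfs Aa a0 as_ Ssa.
    have ms : m <= s by apply: mmin => //; lia.
    have := H (f - s); case; [lia|apply/gapA|apply/gapA|].
    + by rewrite subKn ?(ltnW sf) //; split => //; lia.
    + have -> : f - (f - m - (f - s)) = m + f - s by lia.
      by split => //; lia.
    + move=> _ /(_ a (conj Aa a0)); apply/gapA.
      have -> : f - (f - s + a) = s - a by lia.
      by split => //; lia.
  move=> x y [/S'P S'x /= x0] [/S'P S'y /= y0]; apply/S'P.
  apply: contrapT => nu; have [nSu uf] : ~ S (x + y - m) /\ x + y - m <> f.
    by split=> ?; apply: nu; [left|right].
  have ltuf : x + y - m < f by have := fmax _ nSu; lia.
  (* If [x] were [f], then [m <= y] would give [f <= x + y - m]. *)
  have [Sx mx] : S x /\ m <= x.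
    case: S'x => [Sx|xf]; first by split => //; apply: mmin => //; exact/eqP.
    have my : m <= y by case: S'y => [Sy|->]; [apply: mmin => //; exact/eqP|exact: ltnW].
    by lia.
  have [Sy my] : S y /\ m <= y.
    case: S'y => [Sy|yf]; first by split => //; apply: mmin => //; exact/eqP.
    by lia.
  have [SFu|nSFu] := pselect (S (f - (x + y - m))).
    have mFu : m <= f - (x + y - m) by apply: mmin => //; lia.
    have xyf : x + y <> f by move=> e; apply: nSf; rewrite -e; apply: SD.
    apply: (key (x + y) x) => //; [exact: SD|lia| |by left|lia|by rewrite addKn].
    by have -> : m + f - (x + y) = f - (x + y - m) by lia.
  (* This makes [s = f - (x + y - m) + x = m + f - y] smaller than [f], as [key] requires. *)
  have ym : y <> m by move=> e; apply: nSu; rewrite e addnK.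
  have PFa : pseudo_frobenius S (f - (x + y - m)).
    by apply: LPF; rewrite ?subKn //; [lia|exact: ltnW].
  have Sax := PFa.2 x (conj Sx x0).
  have e : f - (x + y - m) + x = m + f - y by lia.
  apply: (key (f - (x + y - m) + x) (f - (x + y - m))) => //.
  + by lia.
  + by have -> : m + f - (f - (x + y - m) + x) = y by lia.
  + by right.
  + by lia.
  + by lia.
  + by rewrite addKn.
- move=> x xfm nAx /gapA[_ Smx]; split => // a [Aa /= a0].
  have [xf Ss] := (gapA x).1 nAx.
  (* If [x + a] is a gap of A*(S), then [b = f - (x + a)] is a nonzero element of [S]; each case
     below derives that [f] is in [S]. *)
  apply: contrapT => /gapA[xaf Sb].
  have {Smx} Smx : S (m + x) by have <- : f - (f - m - x) = m + x by lia.
  have inS' z : S z -> z <> 0 -> (add_frobenius S `\ 0) z.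
    by move=> Sz z0; split => //; apply/S'P; left.
  have [Sa|nSa] := pselect (S a).
    have ma : m <= a by apply: mmin => //; exact/eqP.
    (* For [a] in [S], the pair [a], [b] yields [f - x - m] in [S], and adding [m + x] gives [f]. *)
    have /S'P[Sd|] := H a (f - (x + a)) (inS' _ Sa a0) (inS' _ Sb ltac:(lia)); last by lia.
    apply: nSf; have -> : f = (a + (f - (x + a)) - m) + (m + x) by lia.
    exact: SD.
  have [//|[_ PFa]] := Aa.
  (* For [a] pseudo-Frobenius, the pair [m + x], [b] yields [f - a] in [S], and adding [a] gives
     [f]. *)
  have /S'P[Sd|] := H (m + x) (f - (x + a)) (inS' _ Smx ltac:(lia)) (inS' _ Sb ltac:(lia)); last by lia.
  apply: nSf; have -> : f = a + ((m + x) + (f - (x + a)) - m) by lia.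
  by apply: PFa; split => //= ?; lia.
Qed.
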